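(* Let $\alpha_1,\alpha_2,\alpha_3\in\mathbb R$, and let $A_{+\frac12,0}\in P^{2,2}$ be the corresponding local 2-d Active Flux test function associated to an edge midpoint. Its expansion in the basis of tensorial test functions $\tilde A_{r,s}(x,y)=A_r(x)A_s(y)$, $r,s\in\{\pm\frac12,0\}$, is $$A_{+\frac12,0}=\frac{8\alpha_1-1-\alpha_3}{2}\,\tilde A_{+\frac12,+\frac12}+\frac{3(1+\alpha_3)}{2}\,\tilde A_{+\frac12,0}+\frac{8\alpha_2-1-\alpha_3}{2}\,\tilde A_{+\frac12,-\frac12}.$$
   Context: Let $\Delta x,\Delta y>0$, $\xi=x/\Delta x$, $\eta=y/\Delta y$, $C=[-\frac{\Delta x}2,\frac{\Delta x}2]\times[-\frac{\Delta y}2,\frac{\Delta y}2]$, and let $P^{2,2}$ be the space of polynomials in $x,y$ of degree at most 2 in each variable. 1-d basis functions ($K=2$): $B_0(x)=\frac32(1-4\xi^2)$, $B_{+\frac12}(x)=\frac14(2\xi+1)(6\xi-1)$, $B_{-\frac12}(x)=\frac14(2\xi-1)(6\xi+1)$. 1-d test functions (with symmetric normalization): $A_0,A_{\pm\frac12}$ are the polynomials of degree at most 2 on $[-\frac{\Delta x}2,\frac{\Delta x}2]$ such that $\int A_rB_s\,\mathrm dx=0$ for $r\ne s$ in $\{\pm\frac12,0\}$, $\int A_0B_0\,\mathrm dx=1$ and $\int A_{+\frac12}B_{+\frac12}\,\mathrm dx=\int A_{-\frac12}B_{-\frac12}\,\mathrm dx=\frac12$ (integrals over $[-\frac{\Delta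 x}2,\frac{\Delta x}2]$); explicitly $A_0=\frac1{\Delta x}$ and $A_{\pm\frac12}=\frac1{\Delta x}\left(-\frac34\pm3\xi+15\xi^2\right)$. In $A_s(y)$ the same definitions are used with $x,\Delta x,\xi$ replaced by $y,\Delta y,\eta$. 2-d basis functions on $C$: $$B_{+\frac12,+\frac12}=\tfrac1{16}(2\xi+1)(2\eta+1)(-1+2\eta+2\xi+12\xi\eta),\quad B_{-\frac12,+\frac12}=\tfrac1{16}(2\xi-1)(2\eta+1)(1-2\eta+2\xi+12\xi\eta),$$ $$B_{-\frac12,-\frac12}=\tfrac1{16}(2\xi-1)(2\eta-1)(-1-2\eta-2\xi+12\xi\eta),\quad B_{+\frac12,-\frac12}=\tfrac1{16}(2\xi+1)(2\eta-1)(1+2\eta-2\xi+12\xi\eta),$$ $$B_{0,+\frac12}=-\tfrac14(4\xi^2-1)(2\eta+1)(6\eta-1),\quad B_{0,-\frac12}=-\tfrac14(4\xi^2-1)(2\eta-1)(6\eta+1),$$ $$B_{-\frac12,0}=-\tfrac14(2\xi-1)(6\xi+1)(4\eta^2-1),\quad B_{+\frac12,0}=-\tfrac14(2\xi+1)(6\xi-1)(4\eta^2-1),$$ $$B_0(x,y)=\tfrac94(4\xi^2-1)(4\eta^2-1).$$ The 2-d test function $A_{+\frac12,0}$ is the (unique) element of $P^{2,2}$ satisfying $$\int_CA_{+\frac12,0}\,B\,\mathrm dx\,\mathrm dy=0\quad\text{for }B\in\{B_0,\,B_{-\frac12,0},\,B_{0,+\frac12},\,B_{0,-\frac12},\,B_{-\frac12,+\frac12},\,B_{-\frac12,-\frac12}\}$$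 ($B_0$ being the 2-d one), together with $$\int_CA_{+\frac12,0}B_{+\frac12,+\frac12}\,\mathrm dx\,\mathrm dy=\alpha_1,\quad\int_CA_{+\frac12,0}B_{+\frac12,-\frac12}\,\mathrm dx\,\mathrm dy=\alpha_2,\quad\int_CA_{+\frac12,0}B_{+\frac12,0}\,\mathrm dx\,\mathrm dy=\frac12+\frac{\alpha_3}2.$$ *)

(* Defs.v *)
From HB Require Import structures.
From mathcomp Require Import all_boot all_order all_algebra.
From mathcomp Require Import all_classical all_reals all_analysis.

Set Implicit Arguments.
Unset Strict Implicit.
Unset Printing Implicit Defensive.

Import Order.TTheory GRing.Theory Num.Theory.
Import numFieldNormedType.Exports.

Local Open Scope classical_set_scope.
Local Open Scope ring_scope.

(* The indices -1/2, 0, +1/2. *)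
Inductive node : Type := Mhalf | Zero | Phalf.

Definition polyfun1 (R : realType) : set (R -> R) :=
  [set f | exists2 p : {poly R}, (size p <= 3)%N & forall x, f x = p.[x]].

(* In p : {poly {poly R}} the outer variable is y and the coefficients are
   polynomials in x. *)
Definition polyfun2 (R : realType) : set (R * R -> R) :=
  [set f | exists p : {poly {poly R}},
    [/\ (size p <= 3)%N, (forall j, (size (p`_j)%R <= 3)%N)
      & forall x y, f (x, y) = p.[y%:P].[x]]].

Definition int1 (R : realType) (h : R) (f : R -> R) : R :=
  \int[lebesgue_measure]_(x in `[- (h / 2), h / 2]) f x.

Definition cell (R : realType) (dx dy : R) : set (R * R) :=
  `[- (dx / 2), dx / 2] `*` `[- (dy / 2), dy / 2].

Definition int2 (R : realType) (dx dy : R) (f : R * R -> R) : R :=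
  \int[(lebesgue_measure \x lebesgue_measure)%E]_(z in cell dx dy) f z.

Definition basis1 (R : realType) (h : R) (r : node) (x : R) : R :=
  let xi := x / h in
  match r with
  | Zero => 3 / 2 * (1 - 4 * xi ^+ 2)
  | Phalf => 1 / 4 * (2 * xi + 1) * (6 * xi - 1)
  | Mhalf => 1 / 4 * (2 * xi - 1) * (6 * xi + 1)
  end.

(* The off-diagonal condition covers the six pairs of distinct indices. *)
Definition is_test1 (R : realType) (h : R) (A : node -> R -> R) : Prop :=
  [/\ (forall r, polyfun1 (A r)),
      (forall r s, r <> s -> int1 h (fun x => A r x * basis1 h s x) = 0),
      int1 h (fun x => A Zero x * basis1 h Zero x) = 1,
      int1 h (fun x => A Phalf x * basis1 h Phalf x) = 1 / 2
    & int1 h (fun x => A Mhalf x * basis1 h Mhalf x) = 1 / 2].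

(* The corner functions are not products of the one-dimensional ones. *)
Definition basis2 (R : realType) (dx dy : R) (r s : node) (z : R * R) : R :=
  let xi := z.1 / dx in
  let eta := z.2 / dy in
  match r, s with
  | Phalf, Phalf => 1 / 16 * (2 * xi + 1) * (2 * eta + 1)
                    * (- 1 + 2 * eta + 2 * xi + 12 * xi * eta)
  | Mhalf, Phalf => 1 / 16 * (2 * xi - 1) * (2 * eta + 1)
                    * (1 - 2 * eta + 2 * xi + 12 * xi * eta)
  | Mhalf, Mhalf => 1 / 16 * (2 * xi - 1) * (2 * eta - 1)
                    * (- 1 - 2 * eta - 2 * xi + 12 * xi * eta)
  | Phalf, Mhalf => 1 / 16 * (2 * xi + 1) * (2 * eta - 1)
                    * (1 + 2 * eta - 2 * xi + 12 * xi * eta)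
  | Zero, Phalf => - (1 / 4) * (4 * xi ^+ 2 - 1) * (2 * eta + 1) * (6 * eta - 1)
  | Zero, Mhalf => - (1 / 4) * (4 * xi ^+ 2 - 1) * (2 * eta - 1) * (6 * eta + 1)
  | Mhalf, Zero => - (1 / 4) * (2 * xi - 1) * (6 * xi + 1) * (4 * eta ^+ 2 - 1)
  | Phalf, Zero => - (1 / 4) * (2 * xi + 1) * (6 * xi - 1) * (4 * eta ^+ 2 - 1)
  | Zero, Zero => 9 / 4 * (4 * xi ^+ 2 - 1) * (4 * eta ^+ 2 - 1)
  end.

Definition is_edge_test2 (R : realType) (dx dy alpha1 alpha2 alpha3 : R)
    (A : R * R -> R) : Prop :=
  let moment r s := int2 dx dy (fun z => A z * basis2 dx dy r s z) in
  [/\ polyfun2 A,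
      [/\ moment Zero Zero = 0, moment Mhalf Zero = 0 & moment Zero Phalf = 0],
      [/\ moment Zero Mhalf = 0, moment Mhalf Phalf = 0
        & moment Mhalf Mhalf = 0]
    & [/\ moment Phalf Phalf = alpha1, moment Phalf Mhalf = alpha2
        & moment Phalf Zero = 1 / 2 + alpha3 / 2]].

(* Main.v *)
Require Import Defs.
From HB Require Import structures.
From mathcomp Require Import all_boot all_order all_algebra.
From mathcomp Require Import all_classical all_reals all_analysis.
From mathcomp Require Import measurable_realfun ring lra.

Import Order.TTheory GRing.Theory Num.Theory.
Import numFieldNormedType.Exports.
Local Open Scope ring_scope.

Set Implicit Arguments.
Unset Strict Implicit.

(** Write b_r for the one-dimensional basis functions, and M(r, s) for the
    integral of A(x, y) b_r(x) b_s(y) over the cell.  The proof is a duality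
    argument.

    In one dimension the b_r separate polynomials of degree at most 2
    ([basis1_separating]), so biorthogonality of the A_r gives the expansion
    p = sum over r of (int p b_r) / (int A_r b_r) A_r for every such p, with
    weights 1 at the center and 2 at the two endpoints ([test1_expansion]).
    Applied first in y and then in x, with the integral of tensor products
    factorizing over the cell ([int2_tensor]), it expands any element of P^{2,2}
    in the tensor test functions with coefficients given by its moments M(r, s)
    ([tensor_expansion]).

    It remains to compute the M(r, s) from the prescribed moments.  The
    two-dimensional basis functions are, up to scalars, tensor products, except
    at the corners, where B_{r,s} = b_r b_s + (b_r b_0 + b_0 b_s) / 6
    ([basis2_corner]).  Hence M(1/2, 0) = 3 (1 + alpha3) / 4, the corner moments
    M(1/2, 1/2) and M(1/2, -1/2) are alpha1 - (1 + alpha3) / 8 and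
    alpha2 - (1 + alpha3) / 8, and all the others vanish.  The weights are 2 for
    the pair (1/2, 0) and 4 for the two corners, which yields the
    coefficients. *)

(** * Integrals of polynomials over an interval *)

Lemma integrable_continuous_itv (R : realType) (f : R -> R) (a b : R) :
  continuous f ->
  (@lebesgue_measure R).-integrable `[a, b]%classic (EFin \o f).
Proof.
move=> cf; apply: continuous_compact_integrable; first exact: segment_compact.
exact: continuous_subspaceT.
Qed.

Lemma int1_is_linear (R : realType) (h : R) :
  linear (fun p : {poly R} => int1 h (horner p) : R^o).
Proof.
move=> k p q; rewrite /int1 /=.
have ip (u : {poly R}) :
  (@lebesgue_measure R).-integrable `[- (h / 2), h / 2]%classic
     (EFin \o horner u).
  by apply: integrable_continuous_itv; exact: continuous_horner.
under eq_Rintegral do rewrite hornerD hornerZ.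
rewrite RintegralD//=.
- by rewrite RintegralZl.
- by rewrite [X in _.-integrable _ X](_ : _ = EFin \o horner (k *: p)) //;
    apply/funext => x /=; rewrite hornerZ.
Qed.

(** The integral over the centered interval of length [h] as a linear form on
    polynomials. *)
Definition int1_poly (R : realType) (h : R) (p : {poly R}) : R^o :=
  int1 h (horner p).

HB.instance Definition _ (R : realType) (h : R) :=
  GRing.isLinear.Build R {poly R} R^o *:%R (@int1_poly R h) (int1_is_linear h).

Lemma int1_polyE (R : realType) (h : R) (f : R -> R) (p : {poly R}) :
  (forall x, f x = p.[x]) -> int1 h f = int1_poly h p.
Proof. by move=> fp; congr int1; apply/funext. Qed.

Lemma int1_poly_deriv (R : realType) (h : R) (F : {poly R}) : 0 < h ->
  int1_poly h F^`() = F.[h / 2] - F.[- (h / 2)].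
Proof.
move=> h0; rewrite /int1_poly /int1 /Rintegral.
rewrite (@continuous_FTC2 _ _ (horner F)).
- by [].
- by rewrite gtrN// divr_gt0.
- by apply: continuous_subspaceT; exact: continuous_horner.
- split=> [x _| |].
  + exact: derivable_horner.
  + by apply: cvg_at_right_filter; exact: continuous_horner.
  + by apply: cvg_at_left_filter; exact: continuous_horner.
- by move=> x _; rewrite -derivE.
Qed.

Lemma int1_quartic (R : realType) (h c0 c1 c2 c3 c4 : R) : 0 < h ->
  int1 h (fun x => c0 + c1 * x + c2 * x ^+ 2 + c3 * x ^+ 3 + c4 * x ^+ 4)
  = c0 * h + c2 * h ^+ 3 / 12 + c4 * h ^+ 5 / 80.
Proof.
move=> h0.
pose F : {poly R} := c0 *: 'X + (c1 / 2) *: 'X^2 + (c2 / 3) *: 'X^3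
  + (c3 / 4) *: 'X^4 + (c4 / 5) *: 'X^5.
rewrite (@int1_polyE _ _ _ F^`()).
  by rewrite int1_poly_deriv// /F !hornerE /=; field.
move=> x; rewrite /F !derivD !derivZ derivX !derivXn !hornerE /=.
by field.
Qed.

(** * One-dimensional expansion in the test functions *)

(** The one-dimensional basis functions as polynomials in the unscaled variable. *)
Definition basis1_poly (R : realType) (h : R) (r : node) : {poly R} :=
  match r with
  | Zero => (3 / 2) *: (1 - 4 *: (h^-1 *: 'X) ^+ 2)
  | Phalf => (1 / 4) *: ((2 / h) *: 'X + 1) * ((6 / h) *: 'X - 1)
  | Mhalf => (1 / 4) *: ((2 / h) *: 'X - 1) * ((6 / h) *: 'X + 1)
  end.

Lemma basis1_polyE (R : realType) (h : R) (r : node) (x : R) :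
  basis1 h r x = (basis1_poly h r).[x].
Proof. by case: r; rewrite /basis1 /basis1_poly !hornerE /=; ring. Qed.

Lemma horner_size3 (R : realType) (p : {poly R}) (x : R) : (size p <= 3)%N ->
  p.[x] = p`_0 + p`_1 * x + p`_2 * x ^+ 2.
Proof.
move=> sp; rewrite (horner_coef_wide _ sp) !big_ord_recl big_ord0 /=.
by rewrite expr0 expr1; ring.
Qed.

(** A polynomial of degree at most 2 whose moments against the three basis
    functions vanish is zero. *)
Lemma basis1_separating (R : realType) (h : R) (p : {poly R}) : 0 < h ->
  (size p <= 3)%N ->
  (forall r, int1_poly h (p * basis1_poly h r) = 0) -> p = 0.
Proof.
move=> h0 sp p0; have hN0 : h != 0 by rewrite gt_eqF.
pose a := p`_0; pose b := p`_1 * h; pose c := p`_2 * h ^+ 2.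
(* The moment of [p], in the scaled coefficients [a], [b], [c], against a basis
   function with scaled coefficients [u], [v], [w]. *)
have E r u v w : (forall x, basis1 h r x = u + v * (x / h) + w * (x / h) ^+ 2) ->
  a * u + (a * w + b * v + c * u) / 12 + c * w / 80 = 0.
  move=> rE; apply: (mulIf hN0); rewrite mul0r -(p0 r).
  rewrite -(@int1_polyE _ _ (fun x => (p`_0) * u
     + (p`_0 * v / h + p`_1 * u) * x
     + (p`_0 * w / h ^+ 2 + p`_1 * v / h + p`_2 * u) * x ^+ 2
     + (p`_1 * w / h ^+ 2 + p`_2 * v / h) * x ^+ 3
     + (p`_2 * w / h ^+ 2) * x ^+ 4)).
    by rewrite int1_quartic// /a /b /c; field.
  by move=> x; rewrite hornerM -basis1_polyE rE (horner_size3 _ sp); field.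
have e1 := E Zero (3 / 2) 0 (- 6) ltac:(by move=> x; rewrite /basis1; field).
have e2 := E Phalf (- 1 / 4) 1 3 ltac:(by move=> x; rewrite /basis1; field).
have e3 := E Mhalf (- 1 / 4) (- 1) 3 ltac:(by move=> x; rewrite /basis1; field).
have a0 : a = 0 by lra.
have b0 : b = 0 by lra.
have c0 : c = 0 by lra.
apply/polyP => i; rewrite coef0; case: i => [//|[|[|i]]].
- by move/eqP: b0; rewrite mulf_eq0 (negPf hN0) orbF => /eqP.
- by move/eqP: c0; rewrite mulf_eq0 expf_eq0 (negPf hN0) orbF => /eqP.
- by rewrite nth_default// (leq_trans sp).
Qed.

(** Any family satisfying the biorthogonality conditions expands every polynomial
    of degree at most 2; the factors 2 are the inverses of the normalization 1/2
    at the endpoints. *)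
Lemma test1_expansion (R : realType) (h : R) (A : node -> R -> R)
    (p : {poly R}) (x : R) : 0 < h -> is_test1 h A -> (size p <= 3)%N ->
  let c r := int1_poly h (p * basis1_poly h r) in
  p.[x] = c Zero * A Zero x + 2 * c Phalf * A Phalf x + 2 * c Mhalf * A Mhalf x.
Proof.
move=> h0 [PA offA nZ nP nM] sp c.
have [a0 sa0 A0] := PA Zero.
have [a1 sa1 A1] := PA Phalf.
have [a2 sa2 A2] := PA Mhalf.
have dual r (a : {poly R}) s : (forall x, A r x = a.[x]) ->
  int1_poly h (a * basis1_poly h s) = int1 h (fun x => A r x * basis1 h s x).
  move=> Aa; apply/esym/int1_polyE => y.
  by rewrite Aa basis1_polyE hornerM.
(* The remainder of the expansion has vanishing moments. *)
pose d := p - (c Zero *: a0 + (2 * c Phalf) *: a1 + (2 * c Mhalf) *: a2).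
suff d0 : d = 0.
  move/eqP: d0; rewrite subr_eq0 => /eqP ->.
  by rewrite !hornerE A0 A1 A2.
apply: (@basis1_separating _ h) => //.
  rewrite (leq_trans (size_polyD _ _))// geq_max sp size_polyN/=.
  rewrite (leq_trans (size_polyD _ _))// geq_max.
  rewrite (leq_trans (size_polyD _ _))/= ?geq_max.
    exact: (leq_trans (size_scale_leq _ _)).
  by rewrite !(leq_trans (size_scale_leq _ _)).
move=> r; rewrite /d mulrBl !mulrDl -!scalerAl linearB !linearD !linearZ /=.
rewrite (dual _ _ _ A0) (dual _ _ _ A1) (dual _ _ _ A2) -/(c r) /GRing.scale/=.
by case: r; rewrite ?nZ ?nP ?nM ?offA//; field.
Qed.

(** * Integration over the cell *)

Section fubini_cell.
Variables (R : realType) (dx dy : R).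
Let mu := @lebesgue_measure R.
Let C := cell dx dy.

Lemma measurable_cell : measurable C.
Proof. exact: measurableX. Qed.

Lemma integrable_cell_tensor (g h : R -> R) : continuous g -> continuous h ->
  (mu \x mu)%E.-integrable C (EFin \o (fun z => g z.1 * h z.2)).
Proof.
move=> cg ch.
have bounded (f : R -> R) (a b : R) : continuous f ->
    exists M, forall x, `[a, b]%classic x -> `|f x| <= M.
  move=> cf.
  have /compact_bounded[M [_ mrt]] := continuous_compact
     (continuous_subspaceT cf) (@segment_compact R a b).
  by exists (M + 1) => x xab; apply: (mrt (M + 1)); [rewrite ltrDl|exists x].
have [M gM] := bounded g (- (dx / 2)) (dx / 2) cg.
have [N hN] := bounded h (- (dy / 2)) (dy / 2) ch.
apply: measurable_bounded_integrable.
- exact: measurable_cell.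
- have fin a b : (mu `[a, b]%classic < +oo)%E.
    exact: compact_finite_measure (@segment_compact R a b).
  rewrite [ltLHS]product_measure1E//.
  by rewrite lte_mul_pinfty// ge0_fin_numE.
- apply: measurable_funTS; apply: measurable_funM.
  + by apply: measurableT_comp => //; exact: continuous_measurable_fun.
  + by apply: measurableT_comp => //; exact: continuous_measurable_fun.
- exists (M * N); split; first exact: num_real.
  move=> K MNK z [z1 z2]; rewrite /= normrM (le_trans _ (ltW MNK))//.
  by rewrite ler_pM// ?gM// hN.
Qed.

(** Fubini for tensor products. *)
Lemma int2_tensor (g h : R -> R) : continuous g -> continuous h ->
  int2 dx dy (fun z => g z.1 * h z.2) = int1 dx g * int1 dy h.
Proof.
move=> cg ch; rewrite /int2 /int1 -/C.
set I := `[- (dx / 2), dx / 2]%classic; set J := `[- (dy / 2), dy / 2]%classic.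
have restr (f : R -> R) (a b : R) : continuous f ->
    mu.-integrable setT (EFin \o (f \_ `[a, b]%classic)).
  move=> cf; rewrite -restrict_EFin.
  apply: (iffLR (integrable_mkcond _ _)) => //.
  exact: integrable_continuous_itv.
have ig : mu.-integrable setT (EFin \o (g \_ I)) := restr _ _ _ cg.
have ih : mu.-integrable setT (EFin \o (h \_ J)) := restr _ _ _ ch.
rewrite [LHS]Rintegral_mkcond [X in _ = X * _]Rintegral_mkcond.
rewrite [X in _ = _ * X]Rintegral_mkcond.
(* Restriction to the cell is the tensor product of the restrictions to the
   sides, so the integrals become integrals over the whole plane and line. *)
have E : ((fun z : R * R => g z.1 * h z.2) \_ C) =
    (fun z => (g \_ I) z.1 * (h \_ J) z.2).
  apply/funext => -[x y]; rewrite !patchE /= /C /cell in_setX /= -/I -/J.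
  by case: (x \in I); case: (y \in J); rewrite /= ?mulr0 ?mul0r.
have igh : (mu \x mu)%E.-integrable setT
    (EFin \o (fun z => (g \_ I) z.1 * (h \_ J) z.2)).
  rewrite -E -restrict_EFin; apply: (iffLR (integrable_mkcond _ _)).
    exact: measurable_cell.
  exact: integrable_cell_tensor.
rewrite E {1}/Rintegral -(integral12_prod_meas1 igh) /fubini_F /=.
under eq_integral => x _.
  under eq_integral do rewrite EFinM.
  rewrite integralZl//=.
  rewrite -(@fineK _ (\int[mu]_y _)%E) ?integrable_fin_num// -/(Rintegral _ _ _).
  rewrite -EFinM.
  over.
by rewrite -/(Rintegral _ _ _) RintegralZr.
Qed.

End fubini_cell.

(** [f] is integrable over the cell and its integral there is [v].  Keeping
    integrability with the value is what makes linearity unconditional. *)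
Definition has_int2 (R : realType) (dx dy : R) (f : R * R -> R) (v : R) : Prop :=
  (lebesgue_measure \x lebesgue_measure)%E.-integrable (cell dx dy) (EFin \o f)
  /\ int2 dx dy f = v.

Section has_int2_theory.
Variables (R : realType) (dx dy : R).
Implicit Types (f g : R * R -> R) (u v k : R).

Lemma has_int2_eq f g v : f =1 g -> has_int2 dx dy f v -> has_int2 dx dy g v.
Proof. by move=> /funext ->. Qed.

Lemma has_int2D f g u v : has_int2 dx dy f u -> has_int2 dx dy g v ->
  has_int2 dx dy (fun z => f z + g z) (u + v).
Proof.
move=> [fi <-] [gi <-]; split; last first.
  by apply: RintegralD => //; exact: measurable_cell.
by apply: (integrableD _ fi gi); exact: measurable_cell.
Qed.

Lemma has_int2Z f k u : has_int2 dx dy f u ->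
  has_int2 dx dy (fun z => k * f z) (k * u).
Proof.
move=> [fi <-]; split; last first.
  by apply: RintegralZl => //; exact: measurable_cell.
by apply: (integrableZl _ k fi); exact: measurable_cell.
Qed.

Lemma has_int2_tensor (p q : {poly R}) :
  has_int2 dx dy (fun z => p.[z.1] * q.[z.2]) (int1_poly dx p * int1_poly dy q).
Proof.
by split; [apply: integrable_cell_tensor|apply: int2_tensor];
  exact: continuous_horner.
Qed.

Lemma has_int2_sum n (F : 'I_n -> R * R -> R) (v : 'I_n -> R) :
  (forall i, has_int2 dx dy (F i) (v i)) ->
  has_int2 dx dy (fun z => \sum_(i < n) F i z) (\sum_(i < n) v i).
Proof.
elim: n F v => [|n IH] F v Fv.
  have <- : int1_poly dx 0 * int1_poly dy 0 = \sum_(i < 0) v i.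
    by rewrite big_ord0 linear0 mul0r.
  by apply: has_int2_eq (has_int2_tensor 0 0) => z; rewrite big_ord0 horner0 mul0r.
rewrite big_ord_recl; apply: has_int2_eq (has_int2D (Fv ord0)
    (IH _ _ (fun i => Fv (lift ord0 i)))) => z.
by rewrite big_ord_recl.
Qed.

End has_int2_theory.

(** * Two-dimensional basis functions in terms of tensor products *)

Lemma basis2_corner (R : realType) (dx dy : R) (r s : node) (z : R * R) :
  r <> Zero -> s <> Zero ->
  basis2 dx dy r s z = basis1 dx r z.1 * basis1 dy s z.2
    + 1 / 6 * (basis1 dx r z.1 * basis1 dy Zero z.2
               + basis1 dx Zero z.1 * basis1 dy s z.2).
Proof.
by case: r; case: s => // _ _; rewrite /basis2 /basis1 /=;
  move: (z.1 / dx) (z.2 / dy) => xi eta; field.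
Qed.

Lemma basis2_horizontal (R : realType) (dx dy : R) (r : node) (z : R * R) :
  r <> Zero ->
  basis2 dx dy r Zero z = 2 / 3 * (basis1 dx r z.1 * basis1 dy Zero z.2).
Proof.
by case: r => // _; rewrite /basis2 /basis1 /=;
  move: (z.1 / dx) (z.2 / dy) => xi eta; field.
Qed.

Lemma basis2_vertical (R : realType) (dx dy : R) (s : node) (z : R * R) :
  s <> Zero ->
  basis2 dx dy Zero s z = 2 / 3 * (basis1 dx Zero z.1 * basis1 dy s z.2).
Proof.
by case: s => // _; rewrite /basis2 /basis1 /=;
  move: (z.1 / dx) (z.2 / dy) => xi eta; field.
Qed.

Lemma basis2_center (R : realType) (dx dy : R) (z : R * R) :
  basis2 dx dy Zero Zero z = basis1 dx Zero z.1 * basis1 dy Zero z.2.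
Proof.
by rewrite /basis2 /basis1 /=;
  move: (z.1 / dx) (z.2 / dy) => xi eta; field.
Qed.

(** * Tensor moments and the expansion in tensor test functions *)

Section tensor_moments.
Variables (R : realType) (dx dy : R) (p : {poly {poly R}}).
Hypotheses (sp : (size p <= 3)%N) (sp_coef : forall j, (size (p`_j)%R <= 3)%N).

(** The integral in y of p(x, y) b_s(y), as a polynomial in x. *)
Definition partial_moment (s : node) : {poly R} :=
  \sum_(j < 3) int1_poly dy ('X^j * basis1_poly dy s) *: p`_j.

(** The integral over the cell of p(x, y) b_r(x) b_s(y), defined as an iterated
    integral; [has_tensor_moment] identifies it with the integral over the cell. *)
Definition tensor_moment (r s : node) : R :=
  int1_poly dx (partial_moment s * basis1_poly dx r).

Lemma size_partial_moment s : (size (partial_moment s) <= 3)%N.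
Proof.
apply: (leq_trans (size_sum _ _ _)); apply/bigmax_leqP => j _.
exact: leq_trans (size_scale_leq _ _) (sp_coef j).
Qed.

Lemma bivariate_horner x y :
  p.[y%:P].[x] = \sum_(j < 3) (p`_j).[x] * y ^+ j.
Proof.
rewrite (horner_coef_wide _ sp) horner_sum; apply: eq_bigr => j _.
by rewrite hornerM -polyC_exp hornerC.
Qed.

Lemma has_tensor_moment (A : R * R -> R) r s :
  (forall x y, A (x, y) = p.[y%:P].[x]) ->
  has_int2 dx dy (fun z => A z * (basis1 dx r z.1 * basis1 dy s z.2))
    (tensor_moment r s).
Proof.
move=> Ap.
have -> : tensor_moment r s = \sum_(j < 3)
    int1_poly dx (p`_j * basis1_poly dx r) *
    int1_poly dy ('X^j * basis1_poly dy s).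
  rewrite /tensor_moment /partial_moment mulr_suml linear_sum.
  apply: eq_bigr => j _.
  by rewrite -scalerAl linearZ; exact: mulrC.
apply: has_int2_eq (has_int2_sum (fun j : 'I_3 => has_int2_tensor dx dy
   (p`_j * basis1_poly dx r) ('X^j * basis1_poly dy s))) => -[x y] /=.
rewrite Ap bivariate_horner mulr_suml; apply: eq_bigr => j _.
by rewrite !hornerM !basis1_polyE hornerXn; ring.
Qed.

(** [row s] is the one-dimensional expansion in x of the s-th partial moment. *)
Lemma tensor_expansion (Ax Ay : node -> R -> R) (x y : R) :
  0 < dx -> 0 < dy -> is_test1 dx Ax -> is_test1 dy Ay ->
  let row s := tensor_moment Zero s * Ax Zero x
    + 2 * tensor_moment Phalf s * Ax Phalf x
    + 2 * tensor_moment Mhalf s * Ax Mhalf x in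
  p.[y%:P].[x] =
    row Zero * Ay Zero y + 2 * row Phalf * Ay Phalf y + 2 * row Mhalf * Ay Mhalf y.
Proof.
move=> dx0 dy0 testx testy row.
have rowE s : row s = (partial_moment s).[x].
  by rewrite (test1_expansion x dx0 testx (size_partial_moment s)).
(* The section of [p] at the fixed abscissa [x], as a polynomial in y. *)
pose px := \sum_(j < 3) (p`_j).[x] *: 'X^j : {poly R}.
have spx : (size px <= 3)%N.
  apply: (leq_trans (size_sum _ _ _)); apply/bigmax_leqP => j _.
  by rewrite (leq_trans (size_scale_leq _ _))// size_polyXn ltn_ord.
have momE s : int1_poly dy (px * basis1_poly dy s) = row s.
  rewrite rowE mulr_suml linear_sum horner_sum; apply: eq_bigr => j _.
  by rewrite -scalerAl linearZ hornerZ; exact: mulrC.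
rewrite -!momE -(test1_expansion _ dy0 testy spx) bivariate_horner.
by rewrite horner_sum; apply: eq_bigr => j _; rewrite hornerZ hornerXn.
Qed.

End tensor_moments.

Unset Implicit Arguments.
Set Strict Implicit.

Theorem theorem3p3 (R : realType) (dx dy : R) (hdx : 0 < dx) (hdy : 0 < dy)
    (Ax Ay : node -> R -> R) (hAx : is_test1 dx Ax) (hAy : is_test1 dy Ay)
    (alpha1 alpha2 alpha3 : R) (A : R * R -> R)
    (hA : is_edge_test2 dx dy alpha1 alpha2 alpha3 A) :
  let tensor (r s : node) (x y : R) : R := Ax r x * Ay s y in
  forall x y : R,
    A (x, y) = (8 * alpha1 - 1 - alpha3) / 2 * tensor Phalf Phalf x y
             + 3 * (1 + alpha3) / 2 * tensor Phalf Zero x y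
             + (8 * alpha2 - 1 - alpha3) / 2 * tensor Phalf Mhalf x y.
Proof.
move=> tensor x y.
case: hA => -[p [sp spj Ap]] [m00 mM0 m0P] [m0M mMP mMM] [mPP mPM mP0].
pose t := tensor_moment dx dy p.
have T r s := has_tensor_moment dx dy sp r s Ap.
have center : int2 dx dy (fun z => A z * basis2 dx dy Zero Zero z) = t Zero Zero.
  apply: (has_int2_eq _ (T Zero Zero)).2 => z.
  by rewrite basis2_center.
have horiz r : r <> Zero ->
    int2 dx dy (fun z => A z * basis2 dx dy r Zero z) = 2 / 3 * t r Zero.
  move=> r0; apply: (has_int2_eq _
    (has_int2Z (2 / 3) (T r Zero))).2 => z.
  by rewrite basis2_horizontal//; ring.
have vert s : s <> Zero ->
    int2 dx dy (fun z => A z * basis2 dx dy Zero s z) = 2 / 3 * t Zero s.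
  move=> s0; apply: (has_int2_eq _
    (has_int2Z (2 / 3) (T Zero s))).2 => z.
  by rewrite basis2_vertical//; ring.
have corner r s : r <> Zero -> s <> Zero ->
    int2 dx dy (fun z => A z * basis2 dx dy r s z)
    = t r s + 1 / 6 * (t r Zero + t Zero s).
  move=> r0 s0; apply: (has_int2_eq _ (has_int2D
    (T r s) (has_int2Z (1 / 6)
      (has_int2D (T r Zero) (T Zero s))))).2 => z.
  by rewrite basis2_corner//; ring.
(* The prescribed moments become linear equations in the [t r s], solved below. *)
rewrite center in m00.
rewrite !horiz// in mM0 mP0.
rewrite !vert// in m0P m0M.
rewrite !corner// in mPP mPM mMP mMM.
rewrite Ap (tensor_expansion sp spj x y hdx hdy hAx hAy) -/t /=.
(* Making [t] opaque keeps the linear solver from unfolding integrals. *)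
clear center horiz vert corner T; clearbody t.
have tM0 : t Mhalf Zero = 0 by lra.
have t0P : t Zero Phalf = 0 by lra.
have t0M : t Zero Mhalf = 0 by lra.
have tP0 : t Phalf Zero = 3 / 4 * (1 + alpha3) by lra.
have tMP : t Mhalf Phalf = 0 by lra.
have tMM : t Mhalf Mhalf = 0 by lra.
have tPP : t Phalf Phalf = alpha1 - (1 + alpha3) / 8 by lra.
have tPM : t Phalf Mhalf = alpha2 - (1 + alpha3) / 8 by lra.
rewrite m00 tM0 t0P t0M tP0 tMP tMM tPP tPM /tensor.
by field.
Qed.
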